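(* There exists a real constant $c>0$ such that for infinitely many positive integers $n$ there exists an $n$-barrycade of height at least $cn$.
   Context: For a positive integer $n$ write $[n]=\{1,2,\ldots,n\}$. For a finite sequence $a=(a_1,\ldots,a_n)$ of integers, its proper partial sums are $s_a(i)=a_1+a_2+\cdots+a_i$ for $i\in[n-1]$, and $S_a=\{s_a(i): i\in[n-1]\}$ is the set of all proper partial sums of $a$ (the full sum $a_1+\cdots+a_n$ is not included). An $n$-barrycade is a collection $(\pi_1,\pi_2,\ldots,\pi_h)$ of permutations of $[n]$ (each $\pi_i$ viewed as a sequence of length $n$ in which every element of $[n]$ appears exactly once) such that $S_{\pi_i}\cap S_{\pi_j}=\emptyset$ for all $i,j\in[h]$ with $i\neq j$. The number $h$ is called its height. *)

(* Defs.v *)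
From mathcomp Require Import all_boot all_order all_algebra.
From mathcomp Require Import boolp classical_sets reals.
Set Implicit Arguments.
Unset Strict Implicit.
Unset Printing Implicit Defensive.

Local Open Scope classical_set_scope.

(* The index i counts the summed entries, so 0 < i < size a leaves out the empty
   sum and the full sum. *)
Definition proper_partial_sums (a : seq nat) : set nat :=
  [set sumn (take i a) | i in [set i : nat | 0 < i < size a]].

(* A permutation of [n] = {1, ..., n}, in one-line notation. *)
Definition is_permutation (n : nat) (s : seq nat) : Prop :=
  perm_eq s (iota 1 n).

Definition is_barrycade (n h : nat) (p : 'I_h -> seq nat) : Prop :=
  (forall i : 'I_h, is_permutation n (p i)) /\
  (forall i j : 'I_h, i <> j ->
     proper_partial_sums (p i) `&` proper_partial_sums (p j) = set0).

(* Main.v *)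
Require Import Defs.
From mathcomp Require Import all_boot all_order all_algebra.
From mathcomp Require Import boolp classical_sets reals.
From mathcomp Require Import zify.
Set Implicit Arguments.
Unset Strict Implicit.
Unset Printing Implicit Defensive.
Import Order.TTheory GRing.Theory Num.Theory.
Local Open Scope ring_scope.

(* Put m = 10 K + 5, n = m - 1. For j < K, row j starts at x_j = 5 j + 2, ends
   with m - x_j, and in between consists of blocks whose sums are multiples of m,
   so that it keeps returning to x_j modulo m; the x_j are distinct and all
   congruent to 2 modulo 5. A pair a, m - a visits only x_j + a in between, which
   is harmless when 5 does not divide a. The multiples of 5 are the obstruction:
   z = 10 w and m - z go into a block r, z, m - z, m - r with r = 1 modulo 5 chosen
   so that x_j + r + z / 2 = m + 3. Its inner sums then are m + 3 - 5 w, m + 3 + 5 w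
   and 2 m + 3 - 5 w, which determine w; since w runs through 1, ..., K
   cyclically with shift j, at any given time different rows have different w. *)

(** * Partial sums of concatenated blocks *)

Section PartialSums.
Local Open Scope nat_scope.

(** The full sum is excluded, so [b] is never added; [scanl] omits its initial value, hence the
    separate [a]. *)
Lemma mem_proper_partial_sums (a b : nat) (l : seq nat) (s : nat) :
  proper_partial_sums (a :: rcons l b) s -> s \in a :: scanl addn a l.
Proof.
move=> [i /= /andP[i0]]; rewrite size_rcons => il <-.
case: i i0 il => // i _ il /=.
have {}il : i <= size l by lia.
rewrite -cats1 takel_cat //.
elim: l a i il => [|y l IH] a [|i] //= il; rewrite ?addn0 ?mem_head //.
by rewrite inE addnA IH ?orbT.
Qed.

Lemma foldl_addn (a : nat) (l : seq nat) : foldl addn a l = a + sumn l.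
Proof. by elim: l a => [|y l IH] a /=; rewrite ?addn0 // IH addnA. Qed.

Lemma sumn_flatten_mkseq (B : nat -> seq nat) (N d : nat) :
  (forall t, t < N -> sumn (B t) = d) -> sumn (flatten (mkseq B N)) = d * N.
Proof.
elim: N => [|N IH] Bd; first by rewrite muln0.
by rewrite mkseqS flatten_rcons sumn_cat IH ?Bd ?mulnS ?(addnC d) // => t tN;
  apply: Bd; lia.
Qed.

Lemma size_flatten_mkseq (B : nat -> seq nat) (N d : nat) :
  (forall t, size (B t) = d) -> size (flatten (mkseq B N)) = d * N.
Proof.
move=> Bd; elim: N => [|N IH]; first by rewrite muln0.
by rewrite mkseqS flatten_rcons size_cat IH Bd mulnS addnC.
Qed.

Lemma mem_flatten_mkseq (B : nat -> seq nat) (N t v : nat) :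
  t < N -> v \in B t -> v \in flatten (mkseq B N).
Proof.
move=> tN vB; apply/flattenP; exists (B t) => //.
by apply/mapP; exists t; rewrite ?mem_iota.
Qed.

Lemma mem_scanl_flatten (B : nat -> seq nat) (N d a s : nat) :
  (forall t, t < N -> sumn (B t) = d) ->
  s \in scanl addn a (flatten (mkseq B N)) ->
  exists2 t, t < N & s \in scanl addn (a + d * t) (B t).
Proof.
elim: N => [|N IH] // Bd; rewrite mkseqS flatten_rcons scanl_cat mem_cat.
have Bd' t : t < N -> sumn (B t) = d by move=> tN; apply: Bd; lia.
rewrite foldl_addn (sumn_flatten_mkseq Bd').
case/orP => [/(IH Bd')[t tN sB]|sB]; first by exists t => //; lia.
by exists N.
Qed.

(** A list of n entries that covers n distinct values cannot repeat any. *)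
Lemma perm_eq_iota1 (n : nat) (s : seq nat) :
  size s = n -> (forall v, 0 < v <= n -> v \in s) -> perm_eq s (iota 1 n).
Proof.
move=> sn sP.
have sub : {subset iota 1 n <= s}.
  by move=> v; rewrite mem_iota => vn; apply: sP; lia.
have su : uniq s by apply: (leq_size_uniq (iota_uniq 1 n) sub); rewrite size_iota sn.
rewrite perm_sym; apply: uniq_perm => //; first exact: iota_uniq.
by apply: (uniq_min_size (iota_uniq 1 n) sub _).2; rewrite size_iota sn.
Qed.

End PartialSums.

(** * Construction of the rows *)

Section Construction.
Local Open Scope nat_scope.

Definition modulus (K : nat) : nat := 10 * K + 5.

Definition start (j : nat) : nat := 5 * j + 2.

(* The slots t < K list the class 2 modulo 5 identically in all rows, except that
   x_j, being used at the start, is replaced by x_K, which starts no row. The slots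
   t >= 2 K list, up to a |-> m - a, the elements of class 1 that are left over by
   the quadruple blocks of row j. *)
Definition pair_elt (K j t : nat) : nat :=
  if t < K then (if t == j then start K else start t)
  else if t < 2 * K then 5 * (t - K) + 3
  else if t - 2 * K + j <= K then 5 * (t - 2 * K) + 1
  else 5 * (3 * K - t) + 4.

Definition pair_block (K j t : nat) : seq nat :=
  [:: pair_elt K j t; modulus K - pair_elt K j t].

Definition level (K j k : nat) : nat := ((k + j) %% K).+1.

(** The solution r of x_j + r + 5 w = m + 3, where w is the level; for j < K the subtraction does
    not truncate, as w <= K. *)
Definition quad_elt (K j k : nat) : nat :=
  5 * (2 * K + 1 - j - level K j k) + 1.

Definition quad_block (K j k : nat) : seq nat :=
  [:: quad_elt K j k; 10 * level K j k;
      modulus K - 10 * level K j k; modulus K - quad_elt K j k].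

Definition row (K j : nat) : seq nat :=
  start j :: rcons (flatten (mkseq (pair_block K j) (3 * K + 1)) ++
                    flatten (mkseq (quad_block K j) K))
                   (modulus K - start j).

Lemma level_bounds (K j k : nat) : j < K -> 0 < level K j k <= K.
Proof. by move=> jK; rewrite /level ltn_mod; lia. Qed.

Lemma level_inj (K k i j : nat) : i < K -> j < K ->
  level K i k = level K j k -> i = j.
Proof.
by move=> iK jK [] /eqP; rewrite eqn_modDl !modn_small // => /eqP.
Qed.

Lemma level_surj (K j w : nat) : j < K -> 0 < w <= K ->
  exists2 k, k < K & level K j k = w.
Proof.
(* The residue of w - 1 - j modulo K, written with K - j to avoid truncation. *)
move=> jK /andP[w0 wK]; exists ((w.-1 + (K - j)) %% K).
  by rewrite ltn_mod; lia.
rewrite /level modnDml -addnA subnK; last by lia.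
by rewrite modnDr modn_small; lia.
Qed.

(** * Partial sums of the rows and their disjointness *)

Lemma start_pair_elt (K j t : nat) : j < K -> t < 3 * K + 1 ->
  start j + pair_elt K j t < modulus K.
Proof.
move=> jK tK; rewrite /pair_elt /start /modulus.
by case: ifP; [case: ifP|case: ifP; [|case: ifP]]; lia.
Qed.

Lemma start_quad_elt (K j k : nat) : j < K ->
  start j + quad_elt K j k + 5 * level K j k = modulus K + 3.
Proof.
by move=> jK; have := level_bounds k jK; rewrite /start /quad_elt /modulus; lia.
Qed.

Lemma sumn_pair_block (K j t : nat) : j < K -> t < 3 * K + 1 ->
  sumn (pair_block K j t) = modulus K.
Proof. by move=> jK tK; have := start_pair_elt jK tK; rewrite /=; lia. Qed.

Lemma sumn_quad_block (K j k : nat) : j < K ->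
  sumn (quad_block K j k) = 2 * modulus K.
Proof.
move=> jK; have lK := level_bounds k jK; have := start_quad_elt k jK.
by rewrite /= /modulus /start; lia.
Qed.

(* The partial sums of row j that lie in [m t, m (t + 1)) are among the m t + o with
   [window K j t o]. A quadruple block occupies two consecutive values of t. *)
Definition window (K j t o : nat) : Prop :=
  [\/ o = start j,
      t < 3 * K + 1 /\ o = start j + pair_elt K j t,
      (exists2 k, k < K & t = 3 * K + 1 + 2 * k /\
         o + 5 * level K j k = modulus K + 3) |
      (exists2 k, k < K & t = 3 * K + 2 + 2 * k /\
         (o = 5 * level K j k + 3 \/ o + 5 * level K j k = modulus K + 3))].

(** Makes t and o the quotient and remainder of m t + o by m. *)
Lemma window_lt (K j t o : nat) : j < K -> window K j t o -> o < modulus K.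
Proof.
move=> jK [->|[tK ->]|[k _ [_]]|[k _ [_ []]]].
- by rewrite /start /modulus; lia.
- exact: start_pair_elt.
- by have := level_bounds k jK; lia.
- by have := level_bounds k jK; rewrite /modulus; lia.
- by have := level_bounds k jK; lia.
Qed.

Lemma row_window (K j s : nat) : j < K -> proper_partial_sums (row K j) s ->
  exists t o, s = modulus K * t + o /\ window K j t o.
Proof.
move=> jK /mem_proper_partial_sums.
rewrite scanl_cat foldl_addn (sumn_flatten_mkseq (d := modulus K)); last first.
  by move=> t tK; apply: sumn_pair_block.
rewrite inE mem_cat => /orP[/eqP->|/orP[]].
- by exists 0, (start j); rewrite muln0; split=> //; constructor 1.
- move/(mem_scanl_flatten (d := modulus K)) => [t tK|t tK].
    exact: sumn_pair_block.
  have := start_pair_elt jK tK.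
  rewrite !inE => lt_m /orP[]/eqP->.
    by exists t, (start j + pair_elt K j t); split; [lia|constructor 2].
  by exists t.+1, (start j); split; [lia|constructor 1].
- move/(mem_scanl_flatten (d := 2 * modulus K)) => [k kK|k kK].
    exact: sumn_quad_block.
  have := level_bounds k jK; have := start_quad_elt k jK.
  rewrite !inE => eq_m lb.
  set T := 3 * K + 1.
  have lt_q : quad_elt K j k <= modulus K by rewrite /quad_elt /modulus; lia.
  have lt_l : 10 * level K j k <= modulus K by rewrite /modulus; lia.
  case/or4P => /eqP->.
  + exists (T + 2 * k), (start j + quad_elt K j k); split; first by lia.
    by constructor 3; exists k.
  + exists (T + 2 * k).+1, (5 * level K j k + 3); split; first by lia.
    by constructor 4; exists k => //; split; [lia|left].
  + exists (T + 2 * k).+1, (start j + quad_elt K j k); split; first by lia.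
    by constructor 4; exists k => //; split; [lia|right].
  + by exists (T + 2 * k).+2, (start j); split; [lia|constructor 1].
Qed.

(** Residues modulo 5 separate the starts from all other offsets; the value of t separates pairs
    from quadruples and fixes the block. *)
Lemma window_inj (K i j t o : nat) : i < K -> j < K ->
  window K i t o -> window K j t o -> i = j.
Proof.
move=> iK jK.
have pe5 l : pair_elt K l t %% 5 != 0.
  rewrite /pair_elt /start.
  by case: ifP; [case: ifP|case: ifP; [|case: ifP]]; lia.
(* In a common slot two rows have equal elements, or x_K against x_t, or classes 1 and 4 modulo
   5. *)
have pe_inj : t < 3 * K + 1 ->
    start i + pair_elt K i t = start j + pair_elt K j t -> i = j.
  rewrite /pair_elt /start; do ![case: ifP => //]; lia.
have pi := pe5 i; have pj := pe5 j.
rewrite /window /start /modulus.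
case=> [Hi|[tK Hi]|[k kK [tk Hi]]|[k kK [tk Hi]]];
  case=> [Hj|[tK' Hj]|[k' kK' [tk' Hj]]|[k' kK' [tk' Hj]]]; try lia.
- by apply: pe_inj => //; rewrite -Hi -Hj.
- have ?: k' = k by lia.
  by subst k'; apply: (level_inj (k := k) iK jK); lia.
- have ?: k' = k by lia.
  (* The mixed case 5 w + 3 = m + 3 - 5 w' would force w + w' = 2 K + 1, but both levels are at most
     K. *)
  subst k'; have := level_bounds k iK; have := level_bounds k jK => li lj.
  by apply: (level_inj (k := k) iK jK); lia.
Qed.

Lemma row_disjoint (K i j s : nat) : i < K -> j < K ->
  proper_partial_sums (row K i) s -> proper_partial_sums (row K j) s -> i = j.
Proof.
move=> iK jK /(row_window iK)[t [o [-> wi]]] /(row_window jK)[t' [o' [E wj]]].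
have o_m := window_lt iK wi; have o'_m := window_lt jK wj.
have Et : t = t'.
  have := congr1 (divn^~ (modulus K)) E.
  by rewrite !(mulnC (modulus K)) !divnMDl ?(divn_small o_m) ?(divn_small o'_m)
    ?addn0; rewrite // /modulus; lia.
subst t'; apply: (window_inj iK jK wi).
by have -> : o = o' by lia.
Qed.

(** * The rows are permutations *)

Lemma size_row (K j : nat) : size (row K j) = (modulus K).-1.
Proof.
rewrite /= size_rcons size_cat (@size_flatten_mkseq _ _ 2) //.
by rewrite (@size_flatten_mkseq _ _ 4) // /modulus; lia.
Qed.

(* [v] is the chosen element of one of the pairs {v, m - v} of row j. *)
Definition representative (K j v : nat) : Prop :=
  [\/ v = start j,
      (exists2 t, t < 3 * K + 1 & v = pair_elt K j t),
      (exists2 k, k < K & v = quad_elt K j k) |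
      (exists2 k, k < K & v = 10 * level K j k)].

Lemma representative_mem (K j v : nat) : representative K j v ->
  v \in row K j /\ modulus K - v \in row K j.
Proof.
rewrite /row !(inE, mem_rcons, mem_cat) => -[->|[t tK ->]|[k kK ->]|[k kK ->]].
- by rewrite !eqxx !orbT.
- by rewrite !(mem_flatten_mkseq tK) ?orbT // !inE eqxx ?orbT.
- by rewrite !(mem_flatten_mkseq (B := quad_block K j) kK) ?orbT // !inE eqxx ?orbT.
- by rewrite !(mem_flatten_mkseq (B := quad_block K j) kK) ?orbT // !inE eqxx ?orbT.
Qed.

Lemma representative_start (K j i : nat) : j < K -> i <= K ->
  representative K j (start i).
Proof.
move=> jK iK; have [->|ij] := eqVneq i j; first by constructor 1.
constructor 2; have [iK'|iK'] := ltnP i K.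
  by exists i; rewrite /pair_elt ?iK' ?(negPf ij) //; lia.
by exists j; rewrite /pair_elt ?jK ?eqxx; [lia|congr start; lia].
Qed.

Lemma representative_mod3 (K j i : nat) : i < K ->
  representative K j (5 * i + 3).
Proof.
move=> iK; constructor 2; exists (K + i); first by lia.
by rewrite /pair_elt; case: ifP => [|_]; [lia|case: ifP; lia].
Qed.

Lemma representative_mod0 (K j w : nat) : j < K -> 0 < w <= K ->
  representative K j (10 * w).
Proof.
by move=> jK /(level_surj jK)[k kK <-]; constructor 4; exists k.
Qed.

(** The quadruples of row j take K - j < i <= 2 K - j; smaller i occur directly in pair slots,
    larger i through their complements. *)
Lemma representative_mod1 (K j i : nat) : j < K -> i <= 2 * K ->
  representative K j (5 * i + 1) \/
  representative K j (modulus K - (5 * i + 1)).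
Proof.
move=> jK iK; have [ij|ij] := leqP (i + j) K.
  left; constructor 2; exists (2 * K + i); first by lia.
  by rewrite /pair_elt; do ![case: ifP => //]; lia.
have [ij'|ij'] := leqP (i + j) (2 * K).
  have [|k kK lk] := level_surj (w := 2 * K + 1 - j - i) jK; first by lia.
  by left; constructor 3; exists k; rewrite // /quad_elt lk; lia.
right; constructor 2; exists (K + i); first by lia.
by rewrite /pair_elt /modulus; do ![case: ifP => //]; lia.
Qed.

(** The map v |-> m - v swaps the classes 1, 4 and 2, 3 modulo 5; among multiples of 5 it swaps odd
    and even, as m is odd. *)
Lemma representative_or (K j v : nat) : j < K -> 0 < v < modulus K ->
  representative K j v \/ representative K j (modulus K - v).
Proof.
move=> jK; rewrite /modulus => vm.
have Ev := divn_eq v 5; have := ltn_pmod v (isT : 0 < 5).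
move: (v %/ 5) (v %% 5) Ev => u [|[|[|[|[|//]]]]] Ev _.
- have := odd_double_half u; case: (odd u) => Eu.
    have -> : 10 * K + 5 - v = 10 * (K - u./2) by lia.
    by right; apply: representative_mod0 => //; lia.
  have -> : v = 10 * u./2 by lia.
  by left; apply: representative_mod0 => //; lia.
- have -> : v = 5 * u + 1 by lia.
  by apply: representative_mod1 => //; lia.
- have [uK|uK] := leqP u K.
    have -> : v = start u by rewrite /start; lia.
    by left; apply: representative_start.
  have -> : 10 * K + 5 - v = 5 * (2 * K - u) + 3 by lia.
  by right; apply: representative_mod3; lia.
- have [uK|uK] := ltnP u K.
    have -> : v = 5 * u + 3 by lia.
    by left; apply: representative_mod3.
  have -> : 10 * K + 5 - v = start (2 * K - u) by rewrite /start; lia.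
  by right; apply: representative_start => //; lia.
- have Ev' : v = modulus K - (5 * (2 * K - u) + 1) by rewrite /modulus; lia.
  have -> : 10 * K + 5 - v = 5 * (2 * K - u) + 1 by lia.
  by rewrite Ev' or_comm; apply: representative_mod1 => //; lia.
Qed.

Lemma row_permutation (K j : nat) : j < K ->
  is_permutation (modulus K).-1 (row K j).
Proof.
move=> jK; apply: perm_eq_iota1; first exact: size_row.
move=> v vm; have {}vm : 0 < v < modulus K by rewrite /modulus in vm *; lia.
case: (representative_or jK vm) => /representative_mem[//].
by rewrite subKn //; lia.
Qed.

End Construction.

Theorem theorem1 (R : realType) :
  exists c : R, 0 < c /\
    forall N : nat, exists n : nat, (N < n)%N /\
      exists (h : nat) (p : 'I_h -> seq nat),
        is_barrycade n p /\ c * n%:R <= h%:R.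
Proof.
(* Here n = 10 K + 4 <= 14 K because K >= 1. *)
exists 14%:R^-1; split; first by rewrite invr_gt0 ltr0n.
move=> N; pose K := N.+1.
exists (modulus K).-1; split; first by rewrite /modulus /K; lia.
exists K, (fun j : 'I_K => row K j); split; last first.
  by rewrite mulrC ler_pdivrMr ?ltr0n // -natrM ler_nat /modulus /K; lia.
split=> [j|i j ij]; first exact: row_permutation.
apply/seteqP; split=> // s [/= si sj]; apply: ij; apply: val_inj.
exact: row_disjoint si sj.
Qed.
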